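(* The following is provable constructively, that is, in intuitionistic logic without the principle of excluded middle and without any form of the axiom of choice (in particular without countable choice), for real numbers defined so that Cauchy sequences of real numbers converge. Let $a \le b$ be real numbers and let $f : [a,b] \to \mathbb{R}$ be pointwise continuous on $[a,b]$, with $f(a) < 0 < f(b)$. Then for every real $\epsilon > 0$ there exists $x \in [a,b]$ such that $|f(x)| < \epsilon$.
   Context: Foundational setting: the mathematics valid in any elementary topos with a natural numbers object. Only intuitionistic logic is used; excluded middle and all forms of choice, including countable choice, are not available. Real numbers: the only requirement on the definition of $\mathbb{R}$ is that Cauchy sequences of real numbers converge. Two admissible definitions are: (1) reals as Dedekind cuts; (2) reals as Cauchy sequences of rationals with specified modulus, i.e. sequences $(q_m)$ of rationals with $|q_m - q_{m'}| < 1/m + 1/m'$ for all $m, m'$ (with the usual equality relation on such sequences, and not defined as equivalence classes). The result is not claimed for reals defined as naive Cauchy sequences of rationals (without a specified modulus) or as equivalence classes of Cauchy sequences. It is not assumed that a real number comes presented with rational approximants; functions respect equality of reals. Pointwise continuity of $f$ on $[a,b]$ means: for every $c \in [a,b]$ and every $\epsilon > 0$ there exists $\delta > 0$ such that for all $x \in [a,b]$ with $|x - c| < \delta$ one has $|f(x) - f(c)| < \epsilon$. Uniform continuity is not assumed (constructively it does not follow from pointwise continuity). *)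

(* Defs.v *)
From Stdlib Require Import List.
Import ListNotations.

(** "Provable constructively" is rendered as derivability in a formal calculus:
    intuitionistic higher-order logic with natural numbers, i.e. the internal
    logic of an elementary topos with a natural numbers object.  It has neither
    excluded middle nor any choice principle, so the axioms of the ambient Rocq
    development cannot leak into the theorem.  The reals are a base type [R] of
    this calculus with uninterpreted operations, constrained only by the list
    [real_axioms] below. *)

(** * Syntax: simply typed terms with de Bruijn variables *)

Inductive ty : Type :=
| R                      (* reals *)
| N                      (* natural numbers *)
| O                      (* truth values *)
| arr (s t : ty).        (* functions; [arr s O] is the power object of [s] *)

Declare Scope ty_scope.
Delimit Scope ty_scope with ty.
Bind Scope ty_scope with ty.
Notation "s ~> t" := (arr s t) (at level 55, right associativity) : ty_scope.

Definition ctx := list ty.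

Inductive var : ctx -> ty -> Type :=
| vz {G s} : var (s :: G) s
| vs {G s t} : var G s -> var (t :: G) s.

Inductive tm (G : ctx) : ty -> Type :=
| tvar {s} : var G s -> tm G s
| tapp {s t} : tm G (s ~> t) -> tm G s -> tm G t
| tlam {s t} : tm (s :: G) t -> tm G (s ~> t)
(* natural numbers and primitive recursion *)
| tO : tm G N
| tS : tm G N -> tm G N
| trec {s} : tm G s -> tm G (N ~> s ~> s) -> tm G N -> tm G s
(* formulas are the terms of type [O]; [teq] is identity on a type *)
| teq {s} : tm G s -> tm G s -> tm G O
| tbot : tm G O
| tand : tm G O -> tm G O -> tm G O
| tor : tm G O -> tm G O -> tm G O
| timp : tm G O -> tm G O -> tm G O
| tall {s} : tm (s :: G) O -> tm G O
| tex {s} : tm (s :: G) O -> tm G O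
(* the language of the reals; [req] is equality of reals, which may be coarser
   than identity (reals need not be equivalence classes) *)
| r0 : tm G R
| r1 : tm G R
| radd : tm G R -> tm G R -> tm G R
| ropp : tm G R -> tm G R
| rmul : tm G R -> tm G R -> tm G R
| rmax : tm G R -> tm G R -> tm G R
| req : tm G R -> tm G R -> tm G O
| rlt : tm G R -> tm G R -> tm G O.

Arguments tvar {G s} _.
Arguments tapp {G s t} _ _.
Arguments tlam {G s t} _.
Arguments tO {G}.
Arguments tS {G} _.
Arguments trec {G s} _ _ _.
Arguments teq {G s} _ _.
Arguments tbot {G}.
Arguments tand {G} _ _.
Arguments tor {G} _ _.
Arguments timp {G} _ _.
Arguments tall {G s} _.
Arguments tex {G s} _.
Arguments r0 {G}.
Arguments r1 {G}.
Arguments radd {G} _ _.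
Arguments ropp {G} _.
Arguments rmul {G} _ _.
Arguments rmax {G} _ _.
Arguments req {G} _ _.
Arguments rlt {G} _ _.

(** * Renaming and substitution *)

Definition vcase {G t} (X : ty -> Type) (z : X t) (f : forall s, var G s -> X s)
    s (v : var (t :: G) s) : X s :=
  match v in var G' s' return
    match G' with
    | [] => unit
    | t' :: G0 => X t' -> (forall s, var G0 s -> X s) -> X s'
    end
  with
  | vz => fun z _ => z
  | vs w => fun _ f => f _ w
  end z f.

(* Also used as a class: instances find the weakening from the context in which
   a variable is bound to the one in which it is used. *)
Class Ren (G D : ctx) := ren_var : forall s, var G s -> var D s.

#[export] Instance ren_id {G} : Ren G G := fun s v => v.
#[export] Instance ren_skip {G D t} (r : Ren G D) : Ren G (t :: D) :=
  fun s v => vs (r s v).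

Definition lift {G D t} (r : Ren G D) : Ren (t :: G) (t :: D) :=
  vcase (var (t :: D)) vz (fun s v => vs (r s v)).

Fixpoint rename {G D} (r : Ren G D) {s} (e : tm G s) {struct e} : tm D s :=
  match e in tm _ s return tm D s with
  | tvar v => tvar (r _ v)
  | tapp f e => tapp (rename r f) (rename r e)
  | tlam e => tlam (rename (lift r) e)
  | tO => tO
  | tS n => tS (rename r n)
  | trec z f n => trec (rename r z) (rename r f) (rename r n)
  | teq e1 e2 => teq (rename r e1) (rename r e2)
  | tbot => tbot
  | tand p q => tand (rename r p) (rename r q)
  | tor p q => tor (rename r p) (rename r q)
  | timp p q => timp (rename r p) (rename r q)
  | tall p => tall (rename (lift r) p)
  | tex p => tex (rename (lift r) p)
  | r0 => r0
  | r1 => r1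
  | radd x y => radd (rename r x) (rename r y)
  | ropp x => ropp (rename r x)
  | rmul x y => rmul (rename r x) (rename r y)
  | rmax x y => rmax (rename r x) (rename r y)
  | req x y => req (rename r x) (rename r y)
  | rlt x y => rlt (rename r x) (rename r y)
  end.

Definition wk {G t s} (e : tm G s) : tm (t :: G) s := rename (ren_skip ren_id) e.

Definition sub (G D : ctx) := forall s, var G s -> tm D s.

Definition up {G D t} (r : sub G D) : sub (t :: G) (t :: D) :=
  vcase (tm (t :: D)) (tvar vz) (fun s v => wk (r s v)).

Fixpoint subst {G D} (r : sub G D) {s} (e : tm G s) {struct e} : tm D s :=
  match e in tm _ s return tm D s with
  | tvar v => r _ v
  | tapp f e => tapp (subst r f) (subst r e)
  | tlam e => tlam (subst (up r) e)
  | tO => tO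
  | tS n => tS (subst r n)
  | trec z f n => trec (subst r z) (subst r f) (subst r n)
  | teq e1 e2 => teq (subst r e1) (subst r e2)
  | tbot => tbot
  | tand p q => tand (subst r p) (subst r q)
  | tor p q => tor (subst r p) (subst r q)
  | timp p q => timp (subst r p) (subst r q)
  | tall p => tall (subst (up r) p)
  | tex p => tex (subst (up r) p)
  | r0 => r0
  | r1 => r1
  | radd x y => radd (subst r x) (subst r y)
  | ropp x => ropp (subst r x)
  | rmul x y => rmul (subst r x) (subst r y)
  | rmax x y => rmax (subst r x) (subst r y)
  | req x y => req (subst r x) (subst r y)
  | rlt x y => rlt (subst r x) (subst r y)
  end.

Definition inst {G t s} (e : tm (t :: G) s) (u : tm G t) : tm G s :=
  subst (vcase (tm G) u (fun s v => tvar v)) e.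

(* [e] with its most recent variable [n] replaced by the successor of [n] *)
Definition inst_succ {G s} (e : tm (N :: G) s) : tm (N :: G) s :=
  subst (vcase (tm (N :: G)) (tS (tvar vz)) (fun s v => tvar (vs v))) e.

(** * Notation for terms and formulas *)

Declare Scope hol_scope.
Delimit Scope hol_scope with hol.
Bind Scope hol_scope with tm.
Open Scope hol_scope.

(* Named binders: in [ALL x : s, p], [x] stands for the variable [vz] of the
   context [s :: G]; the coercion [use] weakens it to the context of each use. *)
Inductive bvar (G : ctx) (s : ty) : Type := bv.
#[global] Hint Mode Ren + + : typeclass_instances.

#[warning="-uniform-inheritance"]
Coercion use {G s D} {r : Ren (s :: G) D} (x : bvar G s) : tm D s :=
  tvar (r s vz).

Definition lam {G s t} (F : bvar G s -> tm (s :: G) t) : tm G (s ~> t) :=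
  tlam (F (bv G s)).
Definition all {G s} (F : bvar G s -> tm (s :: G) O) : tm G O :=
  tall (F (bv G s)).
Definition ex {G s} (F : bvar G s -> tm (s :: G) O) : tm G O :=
  tex (F (bv G s)).

Notation "'LAM' x : s , e" := (lam (fun x : bvar _ s%ty => e))
  (at level 200, x name, s at level 60, right associativity) : hol_scope.
Notation "'ALL' x : s , p" := (all (fun x : bvar _ s%ty => p))
  (at level 200, x name, s at level 60, right associativity) : hol_scope.
Notation "'EX' x : s , p" := (ex (fun x : bvar _ s%ty => p))
  (at level 200, x name, s at level 60, right associativity) : hol_scope.

(* Weakening of a term parameter of a definition to the local context. *)
Notation "^ e" := (rename _ e) (at level 8, e at level 7, only parsing) : hol_scope.

Notation "f @ e" := (tapp f e) (at level 11, left associativity) : hol_scope.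
Notation "e1 = e2" := (teq e1 e2) : hol_scope.
Notation "p /\ q" := (tand p q) : hol_scope.
Notation "p \/ q" := (tor p q) : hol_scope.
Notation "p ==> q" := (timp p q) (at level 90, right associativity) : hol_scope.
Notation "~ p" := (timp p tbot) : hol_scope.

Notation "0" := r0 : hol_scope.
Notation "1" := r1 : hol_scope.
Notation "x + y" := (radd x y) : hol_scope.
Notation "- x" := (ropp x) : hol_scope.
Notation "x - y" := (radd x (ropp y)) : hol_scope.
Notation "x * y" := (rmul x y) : hol_scope.
Notation "x == y" := (req x y) (at level 70) : hol_scope.
Notation "x < y" := (rlt x y) : hol_scope.
Notation "x <= y" := (~ (y < x)) : hol_scope.

Definition abs {G} (x : tm G R) : tm G R := rmax x (- x).

(** * Intuitionistic derivability *)

Reserved Notation "H |- p" (at level 95, p at level 94, no associativity).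

(* [prv H p] is the sequent [H |- p] with free variables in [G]; keeping track
   of [G] makes the calculus sound for possibly empty types. *)
Inductive prv : forall {G : ctx}, list (tm G O) -> tm G O -> Prop :=
| p_hyp G (H : list (tm G O)) p : In p H -> H |- p
| p_bot_e G (H : list (tm G O)) p : H |- tbot -> H |- p
| p_and_i G (H : list (tm G O)) p q : H |- p -> H |- q -> H |- p /\ q
| p_and_e1 G (H : list (tm G O)) p q : H |- p /\ q -> H |- p
| p_and_e2 G (H : list (tm G O)) p q : H |- p /\ q -> H |- q
| p_or_i1 G (H : list (tm G O)) p q : H |- p -> H |- p \/ q
| p_or_i2 G (H : list (tm G O)) p q : H |- q -> H |- p \/ q
| p_or_e G (H : list (tm G O)) p q c :
    H |- p \/ q -> p :: H |- c -> q :: H |- c -> H |- c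
| p_imp_i G (H : list (tm G O)) p q : p :: H |- q -> H |- p ==> q
| p_imp_e G (H : list (tm G O)) p q : H |- p ==> q -> H |- p -> H |- q
| p_all_i G (H : list (tm G O)) s (p : tm (s :: G) O) :
    map wk H |- p -> H |- tall p
| p_all_e G (H : list (tm G O)) s (p : tm (s :: G) O) (e : tm G s) :
    H |- tall p -> H |- inst p e
| p_ex_i G (H : list (tm G O)) s (p : tm (s :: G) O) (e : tm G s) :
    H |- inst p e -> H |- tex p
| p_ex_e G (H : list (tm G O)) s (p : tm (s :: G) O) c :
    H |- tex p -> p :: map wk H |- wk c -> H |- c
(* identity, functional and propositional extensionality *)
| p_eq_refl G (H : list (tm G O)) s (e : tm G s) : H |- e = e
| p_eq_e G (H : list (tm G O)) s (p : tm (s :: G) O) (e1 e2 : tm G s) :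
    H |- e1 = e2 -> H |- inst p e1 -> H |- inst p e2
| p_beta G (H : list (tm G O)) s t (e : tm (s :: G) t) (u : tm G s) :
    H |- tlam e @ u = inst e u
| p_funext G (H : list (tm G O)) s t (f g : tm G (s ~> t)) :
    map wk H |- wk f @ tvar vz = wk g @ tvar vz -> H |- f = g
| p_propext G (H : list (tm G O)) (p q : tm G O) :
    p :: H |- q -> q :: H |- p -> H |- p = q
(* functional relations have graphs of functions: this is unique existence, not
   choice, and holds in every topos *)
| p_unique G (H : list (tm G O)) s t (P : tm G (s ~> t ~> O)) :
    H |- (ALL x : s, EX y : t, ^P @ x @ y /\ ALL z : t, ^P @ x @ z ==> z = y) ->
    H |- EX f : s ~> t, ALL x : s, ^P @ x @ (f @ x)
(* Peano axioms and recursion equations *)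
| p_S_inj G (H : list (tm G O)) m n : H |- tS m = tS n -> H |- m = n
| p_S_O G (H : list (tm G O)) n : H |- tS n = tO -> H |- tbot
| p_ind G (H : list (tm G O)) (p : tm (N :: G) O) :
    H |- inst p tO -> p :: map wk H |- inst_succ p -> H |- tall p
| p_rec_O G (H : list (tm G O)) s (z : tm G s) f : H |- trec z f tO = z
| p_rec_S G (H : list (tm G O)) s (z : tm G s) f n :
    H |- trec z f (tS n) = f @ n @ trec z f n
where "H |- p" := (prv H p).

(** * Real numbers *)

Definition nplus {G} (m n : tm G N) : tm G N :=
  trec n (LAM k : N, LAM i : N, tS i) m.
Definition nle {G} (m n : tm G N) : tm G O :=
  EX k : N, nplus k ^m = ^n.

(* the real number [n] *)
Definition nat_real {G} (n : tm G N) : tm G R :=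
  trec 0 (LAM k : N, LAM x : R, x + 1) n.

(** Constructive ordered field with binary suprema.  [<] is the strict order,
    [x <= y] is the negation of [y < x], and [x < y \/ y < x] is apartness. *)
Definition ordered_field_axioms : list (tm [] O) :=
  [ (* equality of reals *)
    ALL x : R, x == x;
    ALL x : R, ALL y : R, x == y ==> y == x;
    ALL x : R, ALL y : R, ALL z : R, x == y ==> y == z ==> x == z;
    ALL x : R, ALL x' : R, ALL y : R, ALL y' : R,
      x == x' ==> y == y' ==> x + y == x' + y';
    ALL x : R, ALL x' : R, x == x' ==> - x == - x';
    ALL x : R, ALL x' : R, ALL y : R, ALL y' : R,
      x == x' ==> y == y' ==> x * y == x' * y';
    ALL x : R, ALL x' : R, ALL y : R, ALL y' : R,
      x == x' ==> y == y' ==> x < y ==> x' < y';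
    (* commutative ring *)
    ALL x : R, ALL y : R, ALL z : R, x + (y + z) == (x + y) + z;
    ALL x : R, ALL y : R, x + y == y + x;
    ALL x : R, x + 0 == x;
    ALL x : R, x + - x == 0;
    ALL x : R, ALL y : R, ALL z : R, x * (y * z) == (x * y) * z;
    ALL x : R, ALL y : R, x * y == y * x;
    ALL x : R, x * 1 == x;
    ALL x : R, ALL y : R, ALL z : R, x * (y + z) == x * y + x * z;
    (* strict order: irreflexive, transitive, cotransitive, tight *)
    ALL x : R, ~ (x < x);
    ALL x : R, ALL y : R, ALL z : R, x < y ==> y < z ==> x < z;
    ALL x : R, ALL y : R, ALL z : R, x < y ==> x < z \/ z < y;
    ALL x : R, ALL y : R, x <= y ==> y <= x ==> x == y;
    (* order and operations; elements apart from 0 are invertible *)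
    0 < 1;
    ALL x : R, ALL y : R, ALL z : R, x < y ==> x + z < y + z;
    ALL x : R, ALL y : R, 0 < x ==> 0 < y ==> 0 < x * y;
    ALL x : R, x < 0 \/ 0 < x ==> EX y : R, x * y == 1;
    (* [rmax] is the binary supremum *)
    ALL x : R, ALL y : R, x <= rmax x y;
    ALL x : R, ALL y : R, y <= rmax x y;
    ALL x : R, ALL y : R, ALL z : R, x <= z ==> y <= z ==> rmax x y <= z ].

Definition archimedean : tm [] O :=
  ALL x : R, EX n : N, x < nat_real n.

(* [u] is Cauchy with modulus [M]: |u m - u n| < 1 / (k + 1) for m, n >= M k.
   Asking only for the limits of sequences given with a modulus makes this axiom
   true, without choice, both for Dedekind reals and for Cauchy sequences of
   rationals with specified modulus. *)
Definition cauchy_complete : tm [] O :=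
  ALL u : N ~> R, ALL M : N ~> N,
    (ALL k : N, ALL m : N, ALL n : N,
       nle (M @ k) m ==> nle (M @ k) n ==>
       nat_real (tS k) * abs (u @ m - u @ n) < 1) ==>
    EX l : R, ALL e : R, 0 < e ==>
      EX n0 : N, ALL n : N, nle n0 n ==> abs (u @ n - l) < e.

Definition real_axioms : list (tm [] O) :=
  archimedean :: cauchy_complete :: ordered_field_axioms.

(** * Functions on a closed interval *)

(* A function on [a, b] is given by a term [f : R ~> R] of which only the values
   on [a, b] are constrained; conversely every function g on [a, b] extends
   constructively to all reals, as x |-> g (max a (min x b)). *)

Definition in_itv {G} (a b x : tm G R) : tm G O := a <= x /\ x <= b.

Definition respects_eq_on {G} (a b : tm G R) (f : tm G (R ~> R)) : tm G O :=
  ALL x : R, ALL y : R,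
    in_itv ^a ^b x ==> in_itv ^a ^b y ==> x == y ==> ^f @ x == ^f @ y.

Definition continuous_on {G} (a b : tm G R) (f : tm G (R ~> R)) : tm G O :=
  ALL c : R, in_itv ^a ^b c ==>
  ALL e : R, 0 < e ==>
  EX d : R, 0 < d /\
    ALL x : R, in_itv ^a ^b x ==> abs (x - c) < d ==> abs (^f @ x - ^f @ c) < e.

(* Main.v *)
From Stdlib Require Import List BinInt.
From Stdlib Require Ring_polynom InitialRing.

(** The turnstile of the calculus captures the one of goal patterns, so hypotheses
   can be matched only by a tactic defined ahead of that notation. *)
Ltac some_hyp tac := match goal with h : _ |- _ => tac h end.

Require Import Defs.
Import ListNotations.

(** Bisection needs the sign of [f] at the midpoint [c], which cannot be decided.
    What can be decided is a choice between overlapping cases: [f c < 0], or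
    [f c > e / 2], or [|f c| < e].  The next interval is nevertheless given by a
    formula in [f c] in which nothing is chosen: its left end moves from the old
    left end to [c] by the fraction [ramp (2 f(c) / e)], which is [1] when
    [f c <= 0] and [0] when [f c >= e / 2].  So one function of [n] defines the
    interval [[s n, s n + w n]], where [w] halves at each step, and no choice
    principle is used.

    Where [f c] is negative or larger than [e / 2], the new interval is exactly one
    of the two halves and inherits the sign change; in the remaining case [c] is an
    approximate zero.  Hence, by induction on [n], either an approximate zero has
    been met or [f] changes sign on the [n]-th interval
    ([approximate_zero_or_sign_change]).  The intervals are nested and shrink, so
    they close down on a point [c] ([nested_intervals]).  Continuity at that single
    point gives [r > 0] such that [f] is within [e] of [f c] at distance less than
    [r]; for one [n] with [w n < r], either an approximate zero was met, or [f c] is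
    within [e] of a negative and of a positive number, so [|f c| < e]
    ([approximate_intermediate_value]).

    The derivations inside the calculus are built by forcing.  A world is a context
    [G] with a list [H] of hypotheses, and [H |- p] says that [p] is forced at [H].
    Renaming and weakening of derivations ([prv_rename], [prv_weaken]) make forcing
    stable under extension of worlds.  A proof under a binder or a hypothesis of the
    calculus then takes place at an arbitrary later world ([all_intro], [ex_elim],
    [imp_intro]), to which all facts known so far are carried over.  The facts at the
    current world are ordinary Rocq hypotheses and the terms are ordinary Rocq
    variables, so the mathematics reads as in a native proof.  Linear inequalities
    are proved by exhibiting the difference of the two sides as a sum of nonnegative
    terms, checked by a reflexive ring normaliser. *)

(** * Renaming and substitution *)

(** Two functions on the variables of [t :: G] agree once they agree on [vz] and on
    the variables of [G]; this carries every induction on terms below past a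
    binder. *)
Lemma vcase_inv {G t} (P : forall s, var (t :: G) s -> Prop) :
  P t vz -> (forall s v, P s (vs v)) -> forall s v, P s v.
Proof.
  intros Hz Hs s v. revert P Hz Hs.
  refine (match v in var G' s' return
    match G' return var G' s' -> Prop with
    | [] => fun _ => True
    | t :: G => fun v => forall P : forall s, var (t :: G) s -> Prop,
        P t vz -> (forall s v, P s (vs v)) -> P s' v
    end v with vz => _ | vs w => _ end); auto.
Qed.

Lemma rename_ext {G s} (e : tm G s) : forall D (r r' : Ren G D),
  (forall t v, r t v = r' t v) -> rename r e = rename r' e.
Proof.
  induction e; intros D r r' E; cbn; f_equal; auto;
    some_hyp ltac:(fun IH => apply IH);
    apply vcase_inv; cbn; intros; f_equal; auto.
Qed.

Lemma subst_ext {G s} (e : tm G s) : forall D (r r' : sub G D),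
  (forall t v, r t v = r' t v) -> subst r e = subst r' e.
Proof.
  induction e; intros D r r' E; cbn; f_equal; auto;
    some_hyp ltac:(fun IH => apply IH);
    apply vcase_inv; cbn; intros; f_equal; auto.
Qed.

Lemma rename_rename {G s} (e : tm G s) : forall D K (r : Ren G D) (q : Ren D K),
  rename q (rename r e) = rename (fun t v => q t (r t v)) e.
Proof.
  induction e; intros D K r q; cbn; f_equal; auto;
    some_hyp ltac:(fun IH => rewrite IH);
    apply rename_ext, vcase_inv; reflexivity.
Qed.

Lemma subst_rename {G s} (e : tm G s) : forall D K (r : Ren G D) (q : sub D K),
  subst q (rename r e) = subst (fun t v => q t (r t v)) e.
Proof.
  induction e; intros D K r q; cbn; f_equal; auto;
    some_hyp ltac:(fun IH => rewrite IH);
    apply subst_ext, vcase_inv; reflexivity.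
Qed.

(** This case of [rename_rename] is what makes [rename_subst] go through under a
    binder. *)
Lemma rename_lift_wk {G D t s} (r : Ren G D) (e : tm G s) :
  rename (lift r) (wk (t := t) e) = wk (rename r e).
Proof. unfold wk. now rewrite !rename_rename. Qed.

Lemma rename_subst {G s} (e : tm G s) : forall D K (r : sub G D) (q : Ren D K),
  rename q (subst r e) = subst (fun t v => rename q (r t v)) e.
Proof.
  induction e; intros D K r q; cbn; f_equal; auto;
    some_hyp ltac:(fun IH => rewrite IH);
    apply subst_ext, vcase_inv; try reflexivity; intros; apply rename_lift_wk.
Qed.

Lemma subst_id {G s} (e : tm G s) (r : sub G G) :
  (forall t v, r t v = tvar v) -> subst r e = e.
Proof.
  revert r; induction e; intros r E; cbn; f_equal; auto;
    some_hyp ltac:(fun IH => apply IH);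
    apply vcase_inv; try reflexivity; cbn; intros; now rewrite E.
Qed.

Lemma subst_var {G s} (e : tm G s) : forall D (r : Ren G D),
  subst (fun t v => tvar (r t v)) e = rename r e.
Proof.
  intros. rewrite <- (subst_id (rename r e) (fun t v => tvar v)) by reflexivity.
  now rewrite subst_rename.
Qed.

Lemma rename_id {G s} (e : tm G s) : rename ren_id e = e.
Proof. rewrite <- subst_var. now apply subst_id. Qed.

Lemma rename_skip {G D t s} (r : Ren G D) (e : tm G s) :
  rename (ren_skip (t := t) r) e = wk (rename r e).
Proof. unfold wk. now rewrite rename_rename. Qed.

Lemma subst_up_wk {G D t s} (r : sub G D) (e : tm G s) :
  subst (up r) (wk (t := t) e) = wk (subst r e).
Proof. unfold wk. now rewrite subst_rename, rename_subst. Qed.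

Lemma subst_vcase_wk {G D t s} (u : tm D t) (r : sub G D) (e : tm G s) :
  subst (vcase (tm D) u r) (wk e) = subst r e.
Proof. unfold wk. now rewrite subst_rename. Qed.

Lemma subst_tvar {G s} (e : tm G s) : subst (fun t v => tvar v) e = e.
Proof. now apply subst_id. Qed.

Lemma rename_inst {G D t s} (r : Ren G D) (e : tm (t :: G) s) (u : tm G t) :
  rename r (inst e u) = inst (rename (lift r) e) (rename r u).
Proof.
  unfold inst. rewrite rename_subst, subst_rename.
  apply subst_ext, vcase_inv; reflexivity.
Qed.

Lemma rename_inst_succ {G D s} (r : Ren G D) (e : tm (N :: G) s) :
  rename (lift r) (inst_succ e) = inst_succ (rename (lift r) e).
Proof.
  unfold inst_succ. rewrite rename_subst, subst_rename.
  apply subst_ext, vcase_inv; reflexivity.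
Qed.

Lemma map_wk_rename {G D t} (r : Ren G D) (H : list (tm G O)) :
  map (rename (lift r)) (map (wk (t := t)) H) = map wk (map (rename r) H).
Proof. rewrite !map_map. apply map_ext. intros; apply rename_lift_wk. Qed.

(** * Stability of derivations *)

Lemma prv_weaken {G} (H : list (tm G O)) p :
  H |- p -> forall H', incl H H' -> H' |- p.
Proof.
  induction 1; intros H' E; try (econstructor; eauto; fail).
  - eapply p_or_e; [eauto | apply IHprv2 | apply IHprv3];
      apply incl_cons; cbn; auto using incl_tl.
  - apply p_imp_i, IHprv. apply incl_cons; cbn; auto using incl_tl.
  - apply p_all_i, IHprv, incl_map, E.
  - eapply p_ex_e; [eauto | apply IHprv2].
    apply incl_cons; cbn; auto using incl_tl, incl_map.
  - apply p_funext, IHprv, incl_map, E.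
  - apply p_propext; [apply IHprv1 | apply IHprv2];
      apply incl_cons; cbn; auto using incl_tl.
  - apply p_ind; auto. apply IHprv2.
    apply incl_cons; cbn; auto using incl_tl, incl_map.
Qed.

(** Derivations are stable under renaming because every rule is: the rules that
    instantiate a bound variable by [rename_inst] and [rename_inst_succ], those that
    introduce one by [map_wk_rename]. *)
Lemma prv_rename {G} (H : list (tm G O)) p :
  H |- p -> forall D (r : Ren G D), map (rename r) H |- rename r p.
Proof.
  induction 1; intros D r; cbn [rename] in *;
    rewrite ?rename_inst; try (econstructor; eauto; fail).
  - now apply p_hyp, in_map.
  - apply p_all_i. rewrite <- map_wk_rename. apply IHprv.
  - eapply p_ex_i. specialize (IHprv D r). rewrite rename_inst in IHprv. apply IHprv.
  - eapply p_ex_e; [apply IHprv1 |].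
    specialize (IHprv2 _ (lift r)). cbn [map] in IHprv2.
    now rewrite map_wk_rename, rename_lift_wk in IHprv2.
  - eapply p_eq_e; [apply IHprv1 |]. specialize (IHprv2 D r).
    rewrite rename_inst in IHprv2. apply IHprv2.
  - apply p_funext. specialize (IHprv _ (lift r)). cbn in IHprv.
    now rewrite map_wk_rename, !rename_lift_wk in IHprv.
  - pose proof (p_unique _ (map (rename r) H) _ _ (rename r P)) as U.
    specialize (IHprv D r).
    cbn in IHprv, U |- *. rewrite !rename_rename in *. exact (U IHprv).
  - apply p_ind.
    + specialize (IHprv1 D r). rewrite rename_inst in IHprv1. apply IHprv1.
    + specialize (IHprv2 _ (lift r)). cbn [map] in IHprv2.
      now rewrite map_wk_rename, rename_inst_succ in IHprv2.
Qed.

(** * Normal forms of formulas *)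

(** The equations below push renamings and substitutions through the defined
    operations without unfolding them, down to the variables and to the opaque terms
    of the ambient proof.  An opaque term ends up under some iterate of [wk]. *)
Lemma rename_abs {G D} (r : Ren G D) x : rename r (abs x) = abs (rename r x).
Proof. reflexivity. Qed.
Lemma subst_abs {G D} (r : sub G D) x : subst r (abs x) = abs (subst r x).
Proof. reflexivity. Qed.
Lemma rename_nat_real {G D} (r : Ren G D) n :
  rename r (nat_real n) = nat_real (rename r n).
Proof. reflexivity. Qed.
Lemma subst_nat_real {G D} (r : sub G D) n :
  subst r (nat_real n) = nat_real (subst r n).
Proof. reflexivity. Qed.
Lemma rename_nplus {G D} (r : Ren G D) m n :
  rename r (nplus m n) = nplus (rename r m) (rename r n).
Proof. reflexivity. Qed.
Lemma subst_nplus {G D} (r : sub G D) m n :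
  subst r (nplus m n) = nplus (subst r m) (subst r n).
Proof. reflexivity. Qed.

Lemma rename_nle {G D} (r : Ren G D) m n :
  rename r (nle m n) = nle (rename r m) (rename r n).
Proof.
  unfold nle, ex, use. cbn [rename]. rewrite rename_nplus, !rename_skip, !rename_id.
  cbn [rename]. now rewrite !rename_lift_wk.
Qed.
Lemma subst_nle {G D} (r : sub G D) m n :
  subst r (nle m n) = nle (subst r m) (subst r n).
Proof.
  unfold nle, ex, use. cbn [subst]. rewrite subst_nplus, !rename_skip, !rename_id.
  cbn [subst]. now rewrite !subst_up_wk.
Qed.

Create HintDb hol.

#[local] Hint Rewrite @rename_abs @subst_abs @rename_nat_real @subst_nat_real
  @rename_nplus @subst_nplus @rename_nle @subst_nle @rename_skip @rename_id
  @rename_lift_wk @subst_up_wk @subst_vcase_wk @subst_tvar @subst_var : hol.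

(** * Worlds in which the axioms of the reals hold *)

Definition ren_nil {D} : Ren [] D := fun s v => match v with end.

Lemma rename_nil {s} (e : tm [] s) : rename ren_nil e = e.
Proof. rewrite <- rename_id. apply rename_ext. inversion v. Qed.

(** The axioms are closed formulas, so they make sense in every context; a proof
    at a world only has to know that they are among its hypotheses. *)
Class Reals {G} (H : list (tm G O)) : Prop :=
  reals_incl : incl (map (rename ren_nil) real_axioms) H.

#[export] Instance real_axioms_Reals : Reals real_axioms.
Proof.
  unfold Reals. rewrite (map_ext _ (fun e => e)), map_id; auto using incl_refl.
  intros; apply rename_nil.
Qed.

(** * Forcing *)

(** [H'] is a later world than [H]: it has more variables, found through [r], and
    more hypotheses. *)
Definition ext {G D} (r : Ren G D) (H : list (tm G O)) (H' : list (tm D O)) :=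
  incl (map (rename r) H) H'.

Lemma prv_ext {G D r H H'} (E : @ext G D r H H') p : H |- p -> H' |- rename r p.
Proof. intros Hp. eapply prv_weaken, E. now apply prv_rename. Qed.

Lemma Reals_ext {G D r H H'} (E : @ext G D r H H') : Reals H -> Reals H'.
Proof.
  intros A p [q [<- Hq]]%in_map_iff. apply E, in_map_iff.
  exists (rename ren_nil q). split.
  - rewrite rename_rename. apply rename_ext. inversion v.
  - apply A, in_map, Hq.
Qed.

Lemma ext_skip {G t} (H : list (tm G O)) : ext (ren_skip (t := t) ren_id) H (map wk H).
Proof. apply incl_refl. Qed.

Lemma ext_cons {G D} (r : Ren G D) H H' p : ext r H H' -> ext r H (p :: H').
Proof. apply incl_tl. Qed.

(** The body [e] of a binder, read at a later world, for the value [x] there. *)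
Definition at_ext {G D t s} (r : Ren G D) (e : tm (t :: G) s) (x : tm D t) : tm D s :=
  subst (vcase (tm D) x (fun s v => tvar (r s v))) e.

Lemma at_ext_skip {G t s} (e : tm (t :: G) s) :
  at_ext (ren_skip ren_id) e (tvar vz) = e.
Proof. apply subst_id, vcase_inv; reflexivity. Qed.

(** A universal formula is forced as soon as its instances are forced at all later
    worlds; the generic instance at the world with one more variable suffices.  The
    same world serves the existential and the induction rule. *)
Lemma all_intro {G H s} (p : tm (s :: G) O) :
  (forall D (r : Ren G D) H' x, ext r H H' -> H' |- at_ext r p x) -> H |- tall p.
Proof.
  intros F. apply p_all_i. rewrite <- (at_ext_skip p). apply F, ext_skip.
Qed.

Lemma ex_elim {G H s} (p : tm (s :: G) O) c :
  H |- tex p ->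
  (forall D (r : Ren G D) H' x, ext r H H' -> H' |- at_ext r p x -> H' |- rename r c) ->
  H |- c.
Proof.
  intros Hp F. eapply p_ex_e; [exact Hp |].
  apply (F _ (ren_skip ren_id)) with (x := tvar vz); [apply ext_cons, ext_skip |].
  rewrite at_ext_skip. apply p_hyp. now left.
Qed.

Lemma nat_induction {G H} (p : tm (N :: G) O) :
  H |- inst p tO ->
  (forall D (r : Ren G D) H' n, ext r H H' -> H' |- at_ext r p n ->
    H' |- at_ext r p (tS n)) ->
  H |- tall p.
Proof.
  intros H0 F. apply p_ind; auto.
  apply (F _ (ren_skip ren_id)); [apply ext_cons, ext_skip |].
  rewrite at_ext_skip. apply p_hyp. now left.
Qed.

Lemma ext_hyp {G} (H : list (tm G O)) p : ext ren_id H (p :: H).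
Proof. intros x [y [<- Hy]]%in_map_iff. rewrite rename_id. now right. Qed.

Lemma imp_intro {G} {H : list (tm G O)} p q :
  (forall H', ext ren_id H H' -> H' |- p -> H' |- q) -> H |- p ==> q.
Proof. intros F. apply p_imp_i, F; [apply ext_hyp | apply p_hyp; now left]. Qed.

Lemma or_elim {G} {H : list (tm G O)} p q c :
  H |- p \/ q ->
  (forall H', ext ren_id H H' -> H' |- p -> H' |- c) ->
  (forall H', ext ren_id H H' -> H' |- q -> H' |- c) -> H |- c.
Proof.
  intros Hpq Fp Fq. apply (p_or_e _ _ _ _ _ Hpq);
    [apply Fp | apply Fq]; (apply ext_hyp || (apply p_hyp; now left)).
Qed.

Lemma prv_ext_id {G H H'} (E : @ext G G ren_id H H') p : H |- p -> H' |- p.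
Proof. intros h%(prv_ext E). now rewrite rename_id in h. Qed.

(** * Tactics *)

(* Weakenings of variables of the ambient proof are normal; those of compound terms
   are still to be pushed inwards. *)
Ltac has_compound_wk p :=
  match p with
  | context [wk ?t] => lazymatch t with wk _ => fail | _ => assert_fails (is_var t) end
  end.
Ltac has_pending p :=
  match p with
  | context [rename _ _] => idtac
  | context [subst _ _] => idtac
  | _ => has_compound_wk p
  end.

#[local] Arguments vcase {G t} X z f s !v /.
#[local] Arguments up {G D t} r s !v /.
#[local] Arguments lift {G D t} r s !v /.
#[local] Arguments ren_skip {G D t} r s v /.
#[local] Arguments ren_id {G} s v /.

(** Both tactics bring a sequent to its normal form, in which the named binders are
    gone and renamings occur only as [wk] of opaque terms.  All quantified facts are
    kept in this form, so that they can be compared syntactically. *)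
Ltac norm :=
  unfold respects_eq_on, continuous_on, in_itv, all, ex, lam, use, inst, at_ext;
  repeat (lazymatch goal with |- prv _ ?p => has_pending p end;
    try (lazymatch goal with |- prv _ ?p => has_compound_wk p; unfold wk end);
    cbn [rename subst ren_skip ren_id lift up vcase];
    autorewrite with hol).
Ltac norm_in h :=
  unfold respects_eq_on, continuous_on, in_itv, all, ex, lam, use, inst, at_ext
    in h;
  repeat (lazymatch type of h with prv _ ?p => has_pending p end;
    try (lazymatch type of h with prv _ ?p => has_compound_wk p; unfold wk in h end);
    cbn [rename subst ren_skip ren_id lift up vcase] in h;
    autorewrite with hol in h).

(** These carry the whole Rocq context over to the later world given by [E].  In
    [enter] each term [t] of the earlier world is replaced, in all facts, by its
    renaming, which takes over the name [t]; the earlier world is then forgotten. *)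
Ltac enter_id E :=
  repeat some_hyp ltac:(fun h =>
    first [ apply (Reals_ext E) in h | apply (prv_ext_id E) in h ]);
  lazymatch type of E with
  | @ext _ _ _ ?H ?H' => clear E; try (clear H; rename H' into H)
  end.

Ltac enter E :=
  lazymatch type of E with
  | @ext ?G ?D ?r ?H ?H' =>
    repeat some_hyp ltac:(fun h =>
      first [ apply (Reals_ext E) in h | apply (prv_ext E) in h; norm_in h ]);
    norm;
    repeat some_hyp ltac:(fun t =>
      lazymatch type of t with
      | tm G _ =>
          let u := fresh in
          set (u := rename r t) in *; clearbody u; clear t; rename u into t
      end);
    clear E; clear r; try (clear H; rename H' into H); try (clear G; rename D into G)
  end.

Tactic Notation "all_i" ident(x) :=
  norm; apply all_intro;
  let D := fresh "D__" in let r := fresh "r__" in let H' := fresh "H__" in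
  let E := fresh "E__" in intros D r H' x E; enter E.
Tactic Notation "imp_i" ident(h) :=
  apply imp_intro;
  let H' := fresh "H__" in let E := fresh "E__" in intros H' E h; enter_id E.
Tactic Notation "ex_e" constr(p) "as" ident(x) ident(h) :=
  let k := fresh in pose proof p as k; norm_in k;
  apply (ex_elim _ _ k); clear k;
  let D := fresh "D__" in let r := fresh "r__" in let H' := fresh "H__" in
  let E := fresh "E__" in intros D r H' x E h; norm_in h; enter E.
Tactic Notation "or_e" constr(p) "as" ident(h) :=
  apply (or_elim _ _ _ p);
  let H' := fresh "H__" in let E := fresh "E__" in intros H' E h; enter_id E.
Tactic Notation "ind_i" ident(n) ident(h) :=
  norm; apply nat_induction;
  [ norm
  | let D := fresh "D__" in let r := fresh "r__" in let H' := fresh "H__" in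
    let E := fresh "E__" in intros D r H' n E h; norm_in h; enter E ].

(** [get k from h (x, y, h')] applies the derivation [h] to terms and to derivations
    of its premises. *)
Ltac spec_in h ts :=
  lazymatch ts with
  | (?us, ?t) => spec_in h us; spec_in h t
  | ?t => lazymatch type of t with
    | prv _ _ => let k := fresh in
        pose proof (p_imp_e _ _ _ _ h t) as k; clear h; rename k into h
    | _ => apply p_all_e with (e := t) in h; norm_in h
    end
  end.
Tactic Notation "get" ident(k) "from" constr(h) constr(ts) :=
  pose proof h as k; norm_in k; spec_in k ts.
Tactic Notation "and_e" ident(h) "as" ident(h1) ident(h2) :=
  pose proof (p_and_e1 _ _ _ _ h) as h1; pose proof (p_and_e2 _ _ _ _ h) as h2.

(** * The ring of reals *)

(** Axioms are addressed by their position in [real_axioms]. *)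
Lemma real_axiom {G} {H : list (tm G O)} (A : Reals H) k :
  Nat.ltb k (length real_axioms) = true -> H |- rename ren_nil (nth k real_axioms tbot).
Proof.
  intros Hk. apply p_hyp, A, in_map, nth_In, PeanoNat.Nat.ltb_lt, Hk.
Qed.

Tactic Notation "axiom" constr(n) constr(ts) :=
  some_hyp ltac:(fun A => lazymatch type of A with Reals _ =>
    let k := fresh in
    pose proof (real_axiom A n eq_refl) as k;
    cbv [nth real_axioms archimedean cauchy_complete ordered_field_axioms] in k;
    norm_in k; spec_in k ts; exact k end).

Section OrderedField.
Context {G} {H : list (tm G O)} {A : Reals H}.
Implicit Types x y z : tm G R.

Lemma req_refl x : H |- x == x.
Proof. axiom 2 x. Qed.
Lemma req_sym x y : H |- x == y -> H |- y == x.
Proof. intros h. axiom 3 (x, y, h). Qed.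
Lemma req_trans x y z : H |- x == y -> H |- y == z -> H |- x == z.
Proof. intros h k. axiom 4 (x, y, z, h, k). Qed.
Lemma radd_req x x' y y' : H |- x == x' -> H |- y == y' -> H |- x + y == x' + y'.
Proof. intros h k. axiom 5 (x, x', y, y', h, k). Qed.
Lemma ropp_req x x' : H |- x == x' -> H |- - x == - x'.
Proof. intros h. axiom 6 (x, x', h). Qed.
Lemma rmul_req x x' y y' : H |- x == x' -> H |- y == y' -> H |- x * y == x' * y'.
Proof. intros h k. axiom 7 (x, x', y, y', h, k). Qed.
Lemma rlt_req x x' y y' : H |- x == x' -> H |- y == y' -> H |- x < y -> H |- x' < y'.
Proof. intros h k l. axiom 8 (x, x', y, y', h, k, l). Qed.

Lemma radd_assoc x y z : H |- x + (y + z) == (x + y) + z.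
Proof. axiom 9 (x, y, z). Qed.
Lemma radd_comm x y : H |- x + y == y + x.
Proof. axiom 10 (x, y). Qed.
Lemma radd_0_r x : H |- x + 0 == x.
Proof. axiom 11 x. Qed.
Lemma radd_opp_r x : H |- x + - x == 0.
Proof. axiom 12 x. Qed.
Lemma rmul_assoc x y z : H |- x * (y * z) == (x * y) * z.
Proof. axiom 13 (x, y, z). Qed.
Lemma rmul_comm x y : H |- x * y == y * x.
Proof. axiom 14 (x, y). Qed.
Lemma rmul_1_r x : H |- x * 1 == x.
Proof. axiom 15 x. Qed.
Lemma rmul_add_r x y z : H |- x * (y + z) == x * y + x * z.
Proof. axiom 16 (x, y, z). Qed.

Lemma req_equivalence : RelationClasses.Equivalence (fun x y => H |- x == y).
Proof.
  split; [exact req_refl | exact req_sym | exact req_trans].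
Qed.

Lemma real_ring_ext : Ring_theory.ring_eq_ext radd rmul ropp (fun x y => H |- x == y).
Proof.
  split; repeat intro; [now apply radd_req | now apply rmul_req | now apply ropp_req].
Qed.

Lemma real_ring : Ring_theory.ring_theory r0 r1 radd rmul (fun x y => x + - y) ropp
  (fun x y => H |- x == y).
Proof.
  split; intros; auto using radd_comm, radd_assoc, rmul_comm, rmul_assoc, radd_opp_r,
    req_refl.
  - exact (req_trans _ _ _ (radd_comm _ _) (radd_0_r _)).
  - exact (req_trans _ _ _ (rmul_comm _ _) (rmul_1_r _)).
  - refine (req_trans _ _ _ (rmul_comm _ _) (req_trans _ _ _ (rmul_add_r _ _ _) _)).
    apply radd_req; apply rmul_comm.
Qed.

(** The evaluator of the ring normaliser with integer coefficients.  Equality of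
    reals depends on [H], so the normaliser is applied directly, uniformly in the
    world. *)
Definition peval := Ring_polynom.PEeval (R := tm G R) r0 r1 radd rmul
  (fun x y => x + - y) ropp (InitialRing.gen_phiZ r0 r1 radd rmul ropp)
  Ring_theory.id_phi_N (Ring_theory.pow_N r1 rmul).

Definition pnorm := Ring_polynom.norm_subst (C := BinNums.Z)
  BinNums.Z0 (BinNums.Zpos BinNums.xH)
  BinInt.Z.add BinInt.Z.mul BinInt.Z.sub BinInt.Z.opp BinInt.Z.eqb BinInt.Z.quotrem 0 nil.

Lemma ring_identity l p q :
  Ring_polynom.Peq BinInt.Z.eqb (pnorm p) (pnorm q) = true ->
  H |- peval l p == peval l q.
Proof.
  intros E.
  refine (Ring_polynom.ring_correct req_equivalence real_ring_ext
    (Ring_theory.Rth_ARth req_equivalence real_ring_ext real_ring)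
    (InitialRing.gen_phiZ_morph req_equivalence real_ring_ext real_ring)
    (Ring_theory.pow_N_th r1 rmul req_equivalence)
    (InitialRing.Ztriv_div_th req_equivalence _) 0%nat l nil p q I E).
Qed.
End OrderedField.

(** [ring_id] proves an identity of commutative rings between two reals at any
    world. *)
Ltac add_atom x l :=
  lazymatch l with
  | context [cons x _] => l
  | _ => constr:(cons x l)
  end.
Ltac atoms e l :=
  lazymatch e with
  | radd ?x ?y => let l := atoms x l in atoms y l
  | rmul ?x ?y => let l := atoms x l in atoms y l
  | ropp ?x => atoms x l
  | r0 => l
  | r1 => l
  | _ => add_atom e l
  end.
Ltac index x l :=
  lazymatch l with
  | cons x _ => constr:(BinNums.xH)
  | cons _ ?l => let i := index x l in eval compute in (BinPos.Pos.succ i)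
  end.
Ltac reify e l :=
  lazymatch e with
  | radd ?x ?y => let p := reify x l in let q := reify y l in
      constr:(@Ring_polynom.PEadd BinNums.Z p q)
  | rmul ?x ?y => let p := reify x l in let q := reify y l in
      constr:(@Ring_polynom.PEmul BinNums.Z p q)
  | ropp ?x => let p := reify x l in constr:(@Ring_polynom.PEopp BinNums.Z p)
  | r0 => constr:(@Ring_polynom.PEc BinNums.Z BinNums.Z0)
  | r1 => constr:(@Ring_polynom.PEc BinNums.Z (BinNums.Zpos BinNums.xH))
  | _ => let i := index e l in constr:(@Ring_polynom.PEX BinNums.Z i)
  end.
Ltac ring_id :=
  lazymatch goal with
  | |- @prv ?G ?H (req ?x ?y) =>
    let l := atoms x (@nil (tm G R)) in
    let l := atoms y l in
    let p := reify x l in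
    let q := reify y l in
    exact (ring_identity (H := H) l p q eq_refl)
  end.

(** * Order *)

Section Order.
Context {G} {H : list (tm G O)} {A : Reals H}.
Implicit Types x y z : tm G R.

Lemma rlt_irrefl x : H |- x < x -> H |- tbot.
Proof. intros h. axiom 17 (x, h). Qed.
Lemma rlt_trans x y z : H |- x < y -> H |- y < z -> H |- x < z.
Proof. intros h k. axiom 18 (x, y, z, h, k). Qed.
Lemma rlt_cotrans x y z : H |- x < y -> H |- x < z \/ z < y.
Proof. intros h. axiom 19 (x, y, z, h). Qed.
Lemma rle_antisym x y : H |- x <= y -> H |- y <= x -> H |- x == y.
Proof. intros h k. axiom 20 (x, y, h, k). Qed.
Lemma rlt_0_1 : H |- 0 < 1.
Proof.
  some_hyp ltac:(fun A => exact (real_axiom A 21 eq_refl)).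
Qed.
Lemma rlt_add x y z : H |- x < y -> H |- x + z < y + z.
Proof. intros h. axiom 22 (x, y, z, h). Qed.
Lemma rmul_pos x y : H |- 0 < x -> H |- 0 < y -> H |- 0 < x * y.
Proof. intros h k. axiom 23 (x, y, h, k). Qed.
Lemma rinv x : H |- x < 0 \/ 0 < x -> H |- EX y : R, ^x * y == 1.
Proof. intros h. norm. axiom 24 (x, h). Qed.
Lemma rmax_l x y : H |- x <= rmax x y.
Proof. axiom 25 (x, y). Qed.
Lemma rmax_r x y : H |- y <= rmax x y.
Proof. axiom 26 (x, y). Qed.
Lemma rmax_lub x y z : H |- x <= z -> H |- y <= z -> H |- rmax x y <= z.
Proof. intros h k. axiom 27 (x, y, z, h, k). Qed.

Lemma rle_not_lt x y : H |- x <= y -> H |- y < x -> H |- tbot.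
Proof. intros h k. exact (p_imp_e _ _ _ _ h k). Qed.

(** Inequalities are handled through the sign of the difference of their sides; the
    lemmas on sums of signs below then amount to adding inequalities. *)
Lemma rlt_of_pos p x y : H |- 0 < p -> H |- y - x == p -> H |- x < y.
Proof.
  intros h k. apply (rlt_req (0 + x) x (p + x) y); [ring_id | | now apply rlt_add].
  apply (req_trans _ ((y - x) + x)); [apply radd_req; [now apply req_sym | apply req_refl] |].
  ring_id.
Qed.
Lemma pos_of_rlt x y : H |- x < y -> H |- 0 < y - x.
Proof.
  intros h. apply (rlt_req (x + - x) 0 (y + - x)); [ring_id | ring_id |].
  now apply rlt_add.
Qed.
Lemma pos_add x y : H |- 0 < x -> H |- 0 < y -> H |- 0 < x + y.
Proof.
  intros h k. apply (rlt_trans _ y); auto.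
  apply (rlt_of_pos x); auto; ring_id.
Qed.
End Order.

(** [x] lies on one side of the gap between [y] and [z] by cotransitivity, and the
    wrong side is excluded. *)
Lemma rle_lt_trans {G} {H : list (tm G O)} {A : Reals H} x y z :
  H |- x <= y -> H |- y < z -> H |- x < z.
Proof.
  intros h k. or_e (rlt_cotrans _ _ x k) as l; auto.
  apply p_bot_e, (rle_not_lt _ _ h l).
Qed.
Lemma rlt_le {G} {H : list (tm G O)} {A : Reals H} x y : H |- x < y -> H |- x <= y.
Proof. intros h. imp_i k. apply (rlt_irrefl x), (rlt_trans _ _ _ h k). Qed.
Lemma req_le {G} {H : list (tm G O)} {A : Reals H} x y : H |- x == y -> H |- x <= y.
Proof.
  intros h. imp_i k. apply (rlt_irrefl x).
  exact (rlt_req _ _ _ _ (req_sym _ _ h) (req_refl _) k).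
Qed.
Lemma rle_of_nonneg {G} {H : list (tm G O)} {A : Reals H} p x y :
  H |- 0 <= p -> H |- y - x == p -> H |- x <= y.
Proof.
  intros h k. imp_i l. apply (rle_not_lt _ _ h).
  apply (rlt_of_pos (x - y)); [now apply pos_of_rlt |].
  apply (req_trans _ (0 - (y - x))); [| ring_id].
  apply radd_req; [apply req_refl |]. apply ropp_req. now apply req_sym.
Qed.
Lemma nonneg_of_rle {G} {H : list (tm G O)} {A : Reals H} x y :
  H |- x <= y -> H |- 0 <= y - x.
Proof.
  intros h. imp_i l. apply (rle_not_lt _ _ h).
  apply (rlt_of_pos (0 - (y - x))); [now apply pos_of_rlt | ring_id].
Qed.
Lemma pos_add_nonneg {G} {H : list (tm G O)} {A : Reals H} x y :
  H |- 0 < x -> H |- 0 <= y -> H |- 0 < x + y.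
Proof.
  intros h k. apply (rle_lt_trans _ y); auto.
  apply (rlt_of_pos x); auto; ring_id.
Qed.
Lemma nonneg_add_pos {G} {H : list (tm G O)} {A : Reals H} x y :
  H |- 0 <= x -> H |- 0 < y -> H |- 0 < x + y.
Proof.
  intros h k. apply (rle_lt_trans _ x); auto.
  apply (rlt_of_pos y); auto; ring_id.
Qed.
Lemma nonneg_add {G} {H : list (tm G O)} {A : Reals H} x y :
  H |- 0 <= x -> H |- 0 <= y -> H |- 0 <= x + y.
Proof.
  intros h k. imp_i l. apply (rle_not_lt _ _ h).
  apply (rle_lt_trans _ (x + y)); auto.
  apply (rle_of_nonneg y); auto; ring_id.
Qed.

Lemma zero_add {G} {H : list (tm G O)} {A : Reals H} x y :
  H |- x == 0 -> H |- y == 0 -> H |- x + y == 0.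
Proof.
  intros h k. apply (req_trans _ (0 + 0)); [now apply radd_req | ring_id].
Qed.
Lemma zero_of_req {G} {H : list (tm G O)} {A : Reals H} x y :
  H |- x == y -> H |- y - x == 0.
Proof.
  intros h. apply (req_trans _ (y - y)); [| ring_id].
  apply radd_req; [apply req_refl | now apply ropp_req].
Qed.
Lemma req_of_zero {G} {H : list (tm G O)} {A : Reals H} p x y :
  H |- p == 0 -> H |- y - x == p -> H |- x == y.
Proof.
  intros h k. apply (req_trans _ (y - (y - x))); [ring_id |].
  apply (req_trans _ (y - 0)); [| ring_id].
  apply radd_req; [apply req_refl |]. apply ropp_req, (req_trans _ p); auto.
Qed.

(** [linear (h, k, l)] proves a comparison whose difference of sides is, by a ring
    identity, the sum of the differences of the given comparisons.  Equalities are
    tried in both directions; coefficients are provided by repeating a fact or by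
    multiplying it beforehand. *)
Ltac add_certificates p q :=
  lazymatch type of p with
  | prv _ (rlt _ _) => lazymatch type of q with
    | prv _ (rlt _ _) => constr:(pos_add _ _ p q)
    | prv _ (req _ _) => constr:(pos_add_nonneg _ _ p (req_le _ _ (req_sym _ _ q)))
    | _ => constr:(pos_add_nonneg _ _ p q)
    end
  | prv _ (req _ _) => lazymatch type of q with
    | prv _ (rlt _ _) => constr:(nonneg_add_pos _ _ (req_le _ _ (req_sym _ _ p)) q)
    | prv _ (req _ _) => constr:(zero_add _ _ p q)
    | _ => constr:(nonneg_add _ _ (req_le _ _ (req_sym _ _ p)) q)
    end
  | _ => lazymatch type of q with
    | prv _ (rlt _ _) => constr:(nonneg_add_pos _ _ p q)
    | prv _ (req _ _) => constr:(nonneg_add _ _ p (req_le _ _ (req_sym _ _ q)))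
    | _ => constr:(nonneg_add _ _ p q)
    end
  end.

Ltac certificate hs k :=
  lazymatch hs with
  | (?a, ?b) => certificate a ltac:(fun p => certificate b ltac:(fun q =>
      let c := add_certificates p q in k c))
  | _ => lazymatch type of hs with
    | prv _ (rlt _ _) => k (pos_of_rlt _ _ hs)
    | prv _ (req _ _) =>
        first [k (zero_of_req _ _ hs) | k (zero_of_req _ _ (req_sym _ _ hs))]
    | _ => k (nonneg_of_rle _ _ hs)
    end
  end.

Ltac conclude c :=
  lazymatch goal with
  | |- prv _ (rlt _ _) => apply (rlt_of_pos _ _ _ c); ring_id
  | |- prv _ (req _ _) => apply (req_of_zero _ _ _ c); ring_id
  | |- _ => lazymatch type of c with
    | prv _ (rlt _ _) => apply (rle_of_nonneg _ _ _ (rlt_le _ _ c)); ring_id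
    | prv _ (req _ _) =>
        apply (rle_of_nonneg _ _ _ (req_le _ _ (req_sym _ _ c))); ring_id
    | _ => apply (rle_of_nonneg _ _ _ c); ring_id
    end
  end.
Tactic Notation "linear" constr(hs) :=
  first [certificate hs conclude | fail 1 "no certificate"].

(** [<=] is a negation, so a refutation of [x * y < 0] is wanted, and inside it one
    may argue by cases on the signs of [x] and [y]: [x] cannot be
    positive, as then [y] is not positive, hence zero, hence so is the product; so
    [x] is zero, and again so is the product. *)
Lemma rmul_nonneg {G} {H : list (tm G O)} {A : Reals H} x y :
  H |- 0 <= x -> H |- 0 <= y -> H |- 0 <= x * y.
Proof.
  intros h k. imp_i n. apply (rlt_irrefl 0).
  assert (x0 : H |- x == 0).
  { apply rle_antisym; auto. imp_i px.
    assert (y0 : H |- y == 0).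
    { apply rle_antisym; auto. imp_i py.
      apply (rlt_irrefl 0). pose proof (rmul_pos _ _ px py) as l. linear (n, l). }
    apply (rlt_irrefl 0).
    pose proof (rmul_req _ _ _ _ (req_refl x) y0) as e. linear (n, req_sym _ _ e). }
  pose proof (rmul_req _ _ _ _ x0 (req_refl y)) as e. linear (n, req_sym _ _ e).
Qed.

Lemma rle_rmul_l {G} {H : list (tm G O)} {A : Reals H} z x y :
  H |- 0 <= z -> H |- x <= y -> H |- z * x <= z * y.
Proof.
  intros h k. pose proof (rmul_nonneg _ _ h (nonneg_of_rle _ _ k)) as l. linear l.
Qed.

(** Either [0 < x], or [x < x + x], which says the same. *)
Lemma pos_half {G} {H : list (tm G O)} {A : Reals H} x : H |- 0 < x + x -> H |- 0 < x.
Proof. intros h. or_e (rlt_cotrans _ _ x h) as k; auto. linear k. Qed.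

Lemma inverse_nonneg {G} {H : list (tm G O)} {A : Reals H} x y :
  H |- 0 < x -> H |- x * y == 1 -> H |- 0 <= y.
Proof.
  intros h k. imp_i l. apply (rlt_irrefl 0).
  pose proof (rmul_pos _ _ h (pos_of_rlt _ _ l)) as m.
  linear (m, rlt_0_1, req_sym _ _ k).
Qed.

(** The continuous function that is [1] up to [0], then falls linearly and is [0]
    from [1] on, written with maxima only. *)
Definition ramp {G} (t : tm G R) : tm G R := rmax 0 (1 - rmax 0 t).

Lemma ramp_rename {G D} (r : Ren G D) t : rename r (ramp t) = ramp (rename r t).
Proof. reflexivity. Qed.
Lemma ramp_subst {G D} (r : sub G D) t : subst r (ramp t) = ramp (subst r t).
Proof. reflexivity. Qed.
#[local] Hint Rewrite @ramp_rename @ramp_subst : hol.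

Section Max.
Context {G} {H : list (tm G O)} {A : Reals H}.
Implicit Types x y z t : tm G R.

(** The supremum axioms speak of [<=] only.  By cotransitivity the claim holds unless
    [x] and [y] are both strictly below the maximum; then neither exceeds the other,
    as the larger one would be an upper bound, and this too contradicts the maximum
    being least. *)
Lemma rmax_lt x y z : H |- x < z -> H |- y < z -> H |- rmax x y < z.
Proof.
  intros hx hy. or_e (rlt_cotrans _ _ (rmax x y) hx) as kx; auto.
  or_e (rlt_cotrans _ _ (rmax x y) hy) as ky; auto.
  apply p_bot_e.
  assert (yx : H |- y <= x).
  { imp_i l. apply (rle_not_lt (rmax x y) y); auto.
    apply rmax_lub; [now apply rlt_le | apply req_le, req_refl]. }
  refine (rle_not_lt (rmax x y) x _ kx). apply rmax_lub; auto. apply req_le, req_refl.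
Qed.

Lemma abs_lt x e : H |- x < e -> H |- - x < e -> H |- abs x < e.
Proof. apply rmax_lt. Qed.
Lemma lt_of_abs_lt x e : H |- abs x < e -> H |- x < e.
Proof. apply rle_lt_trans, rmax_l. Qed.
Lemma opp_lt_of_abs_lt x e : H |- abs x < e -> H |- - x < e.
Proof. apply rle_lt_trans, rmax_r. Qed.

Lemma ramp_nonneg t : H |- 0 <= ramp t.
Proof. apply rmax_l. Qed.
Lemma ramp_le_1 t : H |- ramp t <= 1.
Proof.
  apply rmax_lub; [apply rlt_le, rlt_0_1 |].
  pose proof (rmax_l 0 t) as h. linear h.
Qed.
Lemma ramp_of_nonpos t : H |- t <= 0 -> H |- ramp t == 1.
Proof.
  intros h. apply rle_antisym; [apply ramp_le_1 |].
  pose proof (rmax_lub 0 t 0 (req_le _ _ (req_refl 0)) h) as k.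
  pose proof (rmax_r 0 (1 - rmax 0 t)) as l. fold (ramp t) in l. linear (k, l).
Qed.
Lemma ramp_of_ge_1 t : H |- 1 <= t -> H |- ramp t == 0.
Proof.
  intros h. apply rle_antisym; [| apply ramp_nonneg].
  apply rmax_lub; [apply req_le, req_refl |].
  pose proof (rmax_r 0 t) as k. linear (h, k).
Qed.
End Max.

(** * Identity, recursion and natural numbers *)

Tactic Notation "ex_i" constr(t) := norm; apply p_ex_i with (e := t); norm.

Section Identity.
Context {G} {H : list (tm G O)}.

Lemma eq_sym {s} (x y : tm G s) : H |- x = y -> H |- y = x.
Proof.
  intros h.
  assert (k : H |- inst (tvar vz = wk x) y) by
    (apply (p_eq_e _ _ _ _ x); [exact h | norm; apply p_eq_refl]).
  norm_in k. exact k.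
Qed.
Lemma eq_trans {s} (x y z : tm G s) : H |- x = y -> H |- y = z -> H |- x = z.
Proof.
  intros h l.
  assert (k : H |- inst (wk x = tvar vz) z) by
    (apply (p_eq_e _ _ _ _ y); [exact l | norm; exact h]).
  norm_in k. exact k.
Qed.
Lemma eq_app {s t} (u : tm G (s ~> t)) m n : H |- m = n -> H |- u @ m = u @ n.
Proof.
  intros h.
  assert (k : H |- inst (wk u @ wk m = wk u @ tvar vz) n) by
    (apply (p_eq_e _ _ _ _ m); [exact h | norm; apply p_eq_refl]).
  norm_in k. exact k.
Qed.
Lemma eq_fun {s t} (u v : tm G (s ~> t)) n : H |- u = v -> H |- u @ n = v @ n.
Proof.
  intros h.
  assert (k : H |- inst (wk u @ wk n = tvar vz @ wk n) v) by
    (apply (p_eq_e _ _ _ _ u); [exact h | norm; apply p_eq_refl]).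
  norm_in k. exact k.
Qed.
Lemma eq_S (m n : tm G N) : H |- m = n -> H |- tS m = tS n.
Proof.
  intros h.
  assert (k : H |- inst (tS (wk m) = tS (tvar vz)) n) by
    (apply (p_eq_e _ _ _ _ m); [exact h | norm; apply p_eq_refl]).
  norm_in k. exact k.
Qed.
Lemma req_of_eq {A : Reals H} (x y : tm G R) : H |- x = y -> H |- x == y.
Proof.
  intros h.
  assert (k : H |- inst (wk x == tvar vz) y) by
    (apply (p_eq_e _ _ _ _ x); [exact h | norm; apply req_refl]).
  norm_in k. exact k.
Qed.

(** Functions of two arguments occur as the steps of recursions. *)
Lemma beta2 {s t u} (e : tm (t :: s :: G) u) a b :
  H |- tlam (tlam e) @ a @ b =
    inst (subst (up (vcase (tm G) a (fun _ v => tvar v))) e) b.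
Proof.
  eapply eq_trans; [apply eq_fun, p_beta |]. apply p_beta.
Qed.

Lemma nplus_O (n : tm G N) : H |- nplus tO n = n.
Proof. apply p_rec_O. Qed.
Lemma nplus_S (m n : tm G N) : H |- nplus (tS m) n = tS (nplus m n).
Proof.
  eapply eq_trans; [apply p_rec_S |].
  pose proof (beta2 (tS (tvar vz)) m (nplus m n)) as k. norm_in k. exact k.
Qed.
Lemma nat_real_O {A : Reals H} : H |- nat_real tO == 0.
Proof. apply req_of_eq, p_rec_O. Qed.
Lemma nat_real_S {A : Reals H} n : H |- nat_real (tS n) == nat_real n + 1.
Proof.
  apply req_of_eq. eapply eq_trans; [apply p_rec_S |].
  pose proof (beta2 (tvar vz + 1) n (nat_real n)) as k. norm_in k. exact k.
Qed.
End Identity.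

Lemma recursion {G} {H : list (tm G O)} {s} (z : tm G s) (f : tm G (N ~> s ~> s)) :
  H |- EX u : N ~> s, u @ tO = ^z /\ ALL n : N, u @ tS n = ^f @ n @ (u @ n).
Proof.
  assert (B : H |- EX u : N ~> s, ALL n : N, u @ n = trec ^z ^f n).
  { ex_i (tlam (trec (wk z) (wk f) (tvar vz))). all_i n.
    pose proof (p_beta G H _ _ (trec (wk z) (wk f) (tvar vz)) n) as k.
    norm_in k. exact k. }
  ex_e B as u E. ex_i u. apply p_and_i.
  - get k from E (@tO G). eapply eq_trans; [exact k | apply p_rec_O].
  - all_i n. get k from E n. get l from E (tS n).
    eapply eq_trans; [exact l |]. eapply eq_trans; [apply p_rec_S |].
    apply eq_app, eq_sym, k.
Qed.

Lemma nplus_O_r {G} {H : list (tm G O)} : H |- ALL n : N, nplus n tO = n.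
Proof.
  ind_i n IH; [apply nplus_O |].
  eapply eq_trans; [apply nplus_S | apply eq_S, IH].
Qed.
Lemma nplus_S_r {G} {H : list (tm G O)} (n : tm G N) :
  H |- ALL m : N, nplus m (tS ^n) = tS (nplus m ^n).
Proof.
  ind_i m IH.
  - eapply eq_trans; [apply nplus_O | apply eq_S, eq_sym, nplus_O].
  - eapply eq_trans; [apply nplus_S | apply eq_S].
    eapply eq_trans; [apply IH | apply eq_sym, nplus_S].
Qed.
Lemma nplus_comm {G} {H : list (tm G O)} (n : tm G N) :
  H |- ALL m : N, nplus m ^n = nplus ^n m.
Proof.
  ind_i m IH.
  - eapply eq_trans; [apply nplus_O |]. get k from (nplus_O_r (H := H)) n. apply eq_sym, k.
  - eapply eq_trans; [apply nplus_S |]. get k from (nplus_S_r (H := H) m) n.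
    eapply eq_trans; [apply eq_S, IH | apply eq_sym, k].
Qed.

Lemma nle_nplus {G} {H : list (tm G O)} (j n : tm G N) :
  H |- nle n (nplus j n).
Proof. unfold nle. ex_i j. apply p_eq_refl. Qed.

Lemma req_app {G} {H : list (tm G O)} {A : Reals H} (u : tm G (N ~> R)) m n :
  H |- m = n -> H |- u @ m == u @ n.
Proof. intros h. apply req_of_eq, eq_app, h. Qed.

Lemma nat_real_nonneg {G} {H : list (tm G O)} {A : Reals H} :
  H |- ALL n : N, 0 <= nat_real n.
Proof.
  ind_i n IH.
  - apply req_le, req_sym, nat_real_O.
  - pose proof (nat_real_S (H := H) n) as e. linear (IH, e, rlt_0_1).
Qed.

(** * Halving sequences *)

Lemma half {G} {H : list (tm G O)} {A : Reals H} : H |- EX h : R, (1 + 1) * h == 1.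
Proof.
  assert (k : H |- 0 < 1 + 1) by exact (pos_add _ _ rlt_0_1 rlt_0_1).
  pose proof (rinv _ (p_or_i2 _ _ _ _ k)) as l. norm_in l. exact l.
Qed.

Lemma halving_sequence {G} {H : list (tm G O)} {A : Reals H} :
  H |- EX v : N ~> R, v @ tO == 1 /\ ALL n : N, v @ tS n + v @ tS n == v @ n.
Proof.
  ex_e half as h Hh.
  ex_e (recursion (H := H) 1 (tlam (tlam (wk (wk h) * tvar vz)))) as v Hv.
  and_e Hv as v0 vS. ex_i v. apply p_and_i; [now apply req_of_eq |].
  all_i n. get k from vS n.
  pose proof (beta2 (H := H) (wk (wk h) * tvar vz) n (v @ n)) as b. norm_in b.
  pose proof (req_of_eq _ _ (eq_trans _ _ _ k b)) as e.
  pose proof (rmul_req _ _ _ _ Hh (req_refl (v @ n))) as m.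
  linear (e, e, m).
Qed.

Lemma halving_pos {G} {H : list (tm G O)} {A : Reals H} (v : tm G (N ~> R)) :
  H |- 0 < v @ tO ->
  H |- (ALL n : N, ^v @ tS n + ^v @ tS n == ^v @ n) ->
  H |- ALL n : N, 0 < ^v @ n.
Proof.
  intros v0 vS. ind_i n IH; [exact v0 |].
  get k from vS n. apply pos_half. linear (IH, k).
Qed.

(** Bernoulli's inequality for powers of one half: in the step from [k] to [k + 1]
    the term is halved, while the factor [k + 1] grows to [k + 2], which is at most
    twice as large. *)
Lemma halving_decay {G} {H : list (tm G O)} {A : Reals H} (v : tm G (N ~> R)) (m : tm G N) :
  H |- (ALL n : N, ^v @ tS n + ^v @ tS n == ^v @ n) ->
  H |- (ALL n : N, 0 < ^v @ n) ->
  H |- ALL k : N, nat_real (tS k) * ^v @ (nplus k ^m) <= ^v @ ^m.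
Proof.
  intros vS vpos. ind_i k IH.
  - pose proof (nat_real_S (H := H) tO) as e. pose proof (nat_real_O (H := H)) as z.
    pose proof (req_app v _ _ (nplus_O (H := H) m)) as l.
    pose proof (rmul_req _ _ _ _ (req_trans _ _ _ e (radd_req _ _ _ _ z (req_refl 1))) l) as f.
    linear f.
  - pose proof (nat_real_S (H := H) k) as e. pose proof (nat_real_S (H := H) (tS k)) as e'.
    get hv from vS (nplus k m).
    pose proof (req_app v _ _ (nplus_S (H := H) k m)) as l.
    pose proof (rmul_req _ _ _ _ e' l) as f.
    set (x := v @ tS (nplus k m)) in *.
    get px from vpos (tS (nplus k m)). fold x in px.
    get nk from (nat_real_nonneg (H := H)) k.
    pose proof (rmul_nonneg _ _ nk (rlt_le _ _ px)) as q.
    pose proof (rmul_req _ _ _ _ (req_refl (nat_real (tS k))) hv) as g.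
    pose proof (rmul_req _ _ _ _ e (req_refl x)) as g'.
    linear (IH, f, g, q, g').
Qed.

(** * Limits *)

Lemma archimedes {G} {H : list (tm G O)} {A : Reals H} (x : tm G R) :
  H |- EX n : N, ^x < nat_real n.
Proof. norm. axiom 0%nat x. Qed.

Lemma cauchy_limit {G} {H : list (tm G O)} {A : Reals H}
    (u : tm G (N ~> R)) (M : tm G (N ~> N)) :
  H |- (ALL k : N, ALL m : N, ALL n : N,
          nle (^M @ k) m ==> nle (^M @ k) n ==>
          nat_real (tS k) * abs (^u @ m - ^u @ n) < 1) ->
  H |- EX l : R, ALL e : R, 0 < e ==>
         EX n0 : N, ALL n : N, nle n0 n ==> abs (^u @ n - l) < e.
Proof. intros h. norm. norm_in h. axiom 1%nat (u, M, h). Qed.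

(** The sequence is [d] times the powers [v] of one half, and the modulus sends [k] to
    [k + K] where [d < K]: [halving_decay] bounds [(k + 1) v (k + K)] by [v K], and
    [(K + 1) v K] by [1], so [d v K < K v K < 1].  The modulus
    is thus an explicit function of [k] and of one bound [K], and nothing is chosen
    for each [k]. *)
Lemma vanishing_halving_sequence {G} {H : list (tm G O)} {A : Reals H} (d : tm G R) :
  H |- 0 <= d ->
  H |- EX w : N ~> R, w @ tO == ^d /\
    (ALL n : N, w @ tS n + w @ tS n == w @ n) /\
    (ALL n : N, 0 <= w @ n) /\
    (EX M : N ~> N, ALL k : N, nat_real (tS k) * w @ (M @ k) < 1).
Proof.
  intros hd. ex_e halving_sequence as v hv. and_e hv as v0 vS.
  assert (vpos : H |- ALL n : N, 0 < ^v @ n).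
  { apply halving_pos; auto. linear (rlt_0_1, v0). }
  assert (hw : H |- EX w : N ~> R, ALL n : N, w @ n == ^d * ^v @ n).
  { ex_i (tlam (wk d * wk v @ tvar vz)). all_i n.
    pose proof (p_beta G H _ _ (wk d * wk v @ tvar vz) n) as b. norm_in b.
    now apply req_of_eq. }
  ex_e hw as w wE. ex_e (archimedes d) as K hK. ex_i w. repeat apply p_and_i.
  - get e from wE (@tO G). pose proof (rmul_req _ _ _ _ (req_refl d) v0) as f.
    linear (e, f).
  - all_i n. get e from wE n. get e' from wE (tS n). get h from vS n.
    pose proof (rmul_req _ _ _ _ (req_refl d) h) as f. linear (e, e', e', f).
  - all_i n. get e from wE n. get p from vpos n.
    pose proof (rmul_nonneg _ _ hd (rlt_le _ _ p)) as f. linear (e, f).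
  - ex_i (tlam (nplus (tvar vz) (wk K))). all_i k.
    pose proof (p_beta G H _ _ (nplus (tvar vz) (wk K)) k) as b. norm_in b.
    pose proof (req_app w _ _ b) as wb. clear b.
    set (Mk := tlam (nplus (tvar vz) (wk K)) @ k) in *.
    pose proof (halving_decay v K vS vpos) as D. spec_in D k.
    pose proof (halving_decay v tO vS vpos) as D0. spec_in D0 K.
    get KO from (nplus_O_r (H := H)) K. pose proof (req_app v _ _ KO) as vK.
    get e from wE (nplus k K). get vKpos from vpos K.
    pose proof (rle_rmul_l _ _ _ hd D) as D'.
    pose proof (rmul_pos _ _ (pos_of_rlt _ _ hK) vKpos) as q.
    pose proof (nat_real_S (H := H) K) as KS.
    pose proof (rmul_req _ _ _ _ KS vK) as KS'.
    pose proof (rmul_req _ _ _ _ (req_refl (nat_real (tS k)))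
      (req_trans _ _ _ wb e)) as we.
    linear (we, D', q, KS', vKpos, D0, v0).
Qed.

Lemma vanishing_lt {G} {H : list (tm G O)} {A : Reals H}
    (w : tm G (N ~> R)) (M : tm G (N ~> N)) (d : tm G R) :
  H |- (ALL n : N, 0 <= ^w @ n) ->
  H |- (ALL k : N, nat_real (tS k) * ^w @ (^M @ k) < 1) ->
  H |- 0 < d ->
  H |- EX n : N, ^w @ n < ^d.
Proof.
  intros wnn wM hd. ex_e (rinv d (p_or_i2 _ _ _ _ hd)) as i hi.
  ex_e (archimedes i) as k hk. ex_i (M @ k).
  get l from wM k. get p from wnn (M @ k). set (x := w @ (M @ k)) in *.
  pose proof (nat_real_S (H := H) k) as e.
  (* d - x = d (1 - (k + 1) x) + x d (k - i) + x d + x (d i - 1) *)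
  pose proof (rmul_pos _ _ hd (pos_of_rlt _ _ l)) as t1.
  pose proof (rmul_nonneg _ _ (rmul_nonneg _ _ p (rlt_le _ _ hd))
    (nonneg_of_rle _ _ (rlt_le _ _ hk))) as t2.
  pose proof (rmul_nonneg _ _ p (rlt_le _ _ hd)) as t3.
  pose proof (rmul_req _ _ _ _ (req_refl x) hi) as t4.
  pose proof (rmul_req _ _ _ _ (req_refl (d * x)) e) as t5.
  linear (t1, t2, t3, t4, t5).
Qed.

Lemma nested_intervals_le {G} {H : list (tm G O)} {A : Reals H}
    (s w : tm G (N ~> R)) (n : tm G N) :
  H |- (ALL n : N, ^s @ n <= ^s @ tS n /\ ^s @ tS n + ^w @ tS n <= ^s @ n + ^w @ n) ->
  H |- ALL j : N, ^s @ ^n <= ^s @ nplus j ^n /\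
    ^s @ nplus j ^n + ^w @ nplus j ^n <= ^s @ ^n + ^w @ ^n.
Proof.
  intros h. ind_i j IH.
  - pose proof (req_app s _ _ (nplus_O (H := H) n)) as e.
    pose proof (req_app w _ _ (nplus_O (H := H) n)) as f.
    apply p_and_i; [linear e | linear (e, f)].
  - and_e IH as IH1 IH2. get k from h (nplus j n). and_e k as k1 k2.
    pose proof (req_app s _ _ (nplus_S (H := H) j n)) as e.
    pose proof (req_app w _ _ (nplus_S (H := H) j n)) as f.
    apply p_and_i; [linear (IH1, k1, e) | linear (IH2, k2, e, f)].
Qed.

(** All later intervals lie in the [M k]-th, whose length is less than
    [1 / (k + 1)]; so their left ends form a Cauchy sequence with modulus [M].  Were
    its limit [c] outside the [n]-th interval, terms close enough to [c] with index
    beyond [n] would be outside as well. *)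
Lemma nested_intervals {G} {H : list (tm G O)} {A : Reals H}
    (s w : tm G (N ~> R)) (M : tm G (N ~> N)) :
  H |- (ALL n : N, ^s @ n <= ^s @ tS n /\ ^s @ tS n + ^w @ tS n <= ^s @ n + ^w @ n) ->
  H |- (ALL n : N, 0 <= ^w @ n) ->
  H |- (ALL k : N, nat_real (tS k) * ^w @ (^M @ k) < 1) ->
  H |- EX c : R, ALL n : N, ^s @ n <= c /\ c <= ^s @ n + ^w @ n.
Proof.
  intros nest wnn wM.
  assert (later : H |- ALL m : N, ALL n : N, nle m n ==>
    ^s @ m <= ^s @ n /\ ^s @ n + ^w @ n <= ^s @ m + ^w @ m).
  { all_i m. all_i n. imp_i l. ex_e l as j e.
    pose proof (nested_intervals_le s w m nest) as k. spec_in k j. and_e k as k1 k2.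
    pose proof (req_app s _ _ e) as se. pose proof (req_app w _ _ e) as we.
    apply p_and_i; [linear (k1, se) | linear (k2, se, we)]. }
  norm_in later.
  assert (lim : H |- EX l : R, ALL e : R, 0 < e ==>
         EX n0 : N, ALL n : N, nle n0 n ==> abs (^s @ n - l) < e).
  { apply (cauchy_limit s M). all_i k. all_i m. all_i n. imp_i hm. imp_i hn.
    get lm from later (M @ k, m, hm). and_e lm as lm1 lm2.
    get ln from later (M @ k, n, hn). and_e ln as ln1 ln2.
    get pm from wnn m. get pn from wnn n. get l from wM k.
    assert (bound : H |- abs (s @ m - s @ n) <= w @ (M @ k)).
    { apply rmax_lub; [linear (lm2, pm, ln1) | linear (ln2, pn, lm1)]. }
    pose proof (nat_real_nonneg (H := H)) as nn. spec_in nn (tS k).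
    pose proof (rle_rmul_l _ _ _ nn bound) as q. linear (l, q). }
  ex_e lim as c hc. ex_i c. all_i n.
  (* [n0 + n] is beyond both [n0], where the limit takes effect, and [n]. *)
  assert (tail : H |- ALL e : R, 0 < e ==> EX m : N, nle ^n m /\ abs (^s @ m - ^c) < e).
  { all_i e. imp_i he. get k from hc (e, he). ex_e k as n0 hn0.
    ex_i (nplus n0 n). apply p_and_i; [apply nle_nplus |].
    assert (l : H |- nle n0 (nplus n0 n)).
    { unfold nle. ex_i n. get q from (nplus_comm (H := H) n0) n. exact q. }
    get q from hn0 (nplus n0 n, l). exact q. }
  norm_in tail. get pn from wnn n.
  apply p_and_i; imp_i k.
  - get t from tail (s @ n - c, pos_of_rlt _ _ k). ex_e t as m hm. and_e hm as m1 m2.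
    get l from later (n, m, m1). and_e l as l1 l2.
    pose proof (lt_of_abs_lt _ _ m2) as q. apply (rlt_irrefl 0). linear (q, l1).
  - get t from tail (c - (s @ n + w @ n), pos_of_rlt _ _ k). ex_e t as m hm.
    and_e hm as m1 m2. get l from later (n, m, m1). and_e l as l1 l2.
    pose proof (opp_lt_of_abs_lt _ _ m2) as q. get pm from wnn m.
    apply (rlt_irrefl 0). linear (q, l2, pm).
Qed.

(** * Approximate zeros *)

(** The left ends of the intervals.  [s n + w (n + 1)] is the midpoint of
    [[s n, s n + w n]], and [i] is the inverse of half the tolerance. *)
Lemma bisection_sequence {G} {H : list (tm G O)} {A : Reals H}
    (a i : tm G R) (f : tm G (R ~> R)) (w : tm G (N ~> R)) :
  H |- EX s : N ~> R, s @ tO == ^a /\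
    ALL n : N, s @ tS n ==
      s @ n + ramp (^i * ^f @ (s @ n + ^w @ tS n)) * ^w @ tS n.
Proof.
  ex_e (recursion (H := H) a (LAM n : N, LAM x : R,
    x + ramp (^i * ^f @ (x + ^w @ tS n)) * ^w @ tS n)) as s hs.
  and_e hs as s0 sS. ex_i s. apply p_and_i; [now apply req_of_eq |].
  all_i n. get k from sS n.
  pose proof (eq_trans _ _ _ k (beta2 _ _ _)) as b. norm_in b.
  now apply req_of_eq.
Qed.

(** In the induction step, [c] being the midpoint, cotransitivity decides between
    [- e < f c] and [f c < 0], and in the first case between [1 < i f(c)] and
    [i f(c) < 2], that is between [d < f c] and [f c < e].  When [f c < 0] the ramp
    is [1] and the new interval is the right half, when [d < f c] it is [0] and the
    new interval is the left half; otherwise [|f c| < e]. *)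
Lemma approximate_zero_or_sign_change {G} {H : list (tm G O)} {A : Reals H}
    (a b e d i : tm G R) (f : tm G (R ~> R)) (s w : tm G (N ~> R)) :
  H |- respects_eq_on a b f ->
  H |- f @ a < 0 ->
  H |- 0 < f @ b ->
  H |- 0 < d ->
  H |- d + d == e ->
  H |- d * i == 1 ->
  H |- s @ tO == a ->
  H |- w @ tO == b - a ->
  H |- (ALL n : N, ^w @ tS n + ^w @ tS n == ^w @ n) ->
  H |- (ALL n : N, 0 <= ^w @ n) ->
  H |- (ALL n : N, ^s @ tS n ==
          ^s @ n + ramp (^i * ^f @ (^s @ n + ^w @ tS n)) * ^w @ tS n) ->
  H |- (ALL n : N, ^a <= ^s @ n /\ ^s @ n + ^w @ n <= ^b) ->
  H |- ALL n : N, (EX x : R, in_itv ^a ^b x /\ abs (^f @ x) < ^e) \/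
    (^f @ (^s @ n) < 0 /\ 0 < ^f @ (^s @ n + ^w @ n)).
Proof.
  intros hf fa fb hd de di s0 w0 wS wnn sS dom.
  assert (left_itv : H |- ALL n : N, in_itv ^a ^b (^s @ n)).
  { all_i n. get k from dom n. and_e k as k1 k2. get p from wnn n.
    apply p_and_i; [exact k1 | linear (k2, p)]. }
  assert (right_itv : H |- ALL n : N, in_itv ^a ^b (^s @ n + ^w @ n)).
  { all_i n. get k from dom n. and_e k as k1 k2. get p from wnn n.
    apply p_and_i; [linear (k1, p) | exact k2]. }
  norm_in hf. norm_in left_itv. norm_in right_itv.
  ind_i n IH.
  - apply p_or_i2. get l from left_itv (@tO G). get r from right_itv (@tO G).
    get p from wnn (@tO G).
    assert (hab : H |- a <= b) by linear (p, w0).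
    assert (a_itv : H |- a <= a /\ a <= b) by
      (apply p_and_i; [apply req_le, req_refl | exact hab]).
    assert (b_itv : H |- a <= b /\ b <= b) by
      (apply p_and_i; [exact hab | apply req_le, req_refl]).
    assert (er : H |- s @ tO + w @ tO == b) by linear (s0, w0).
    get fl from hf (s @ tO, a, l, a_itv, s0).
    get fr from hf (s @ tO + w @ tO, b, r, b_itv, er).
    apply p_and_i; [linear (fa, fl) | linear (fb, fr)].
  - or_e IH as sign; [now apply p_or_i1 |].
    and_e sign as fs fsw.
    get hw from wS n. get wp from wnn (tS n). get step from sS n.
    get l from left_itv n. get r from right_itv n.
    get l' from left_itv (tS n). get r' from right_itv (tS n).
    set (v := w @ tS n) in *. set (s' := s @ tS n) in *.
    assert (c_itv : H |- a <= s @ n + v /\ s @ n + v <= b).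
    { and_e l as l1 l2. and_e r as r1 r2.
      apply p_and_i; [linear (l1, wp) | linear (r2, hw, wp)]. }
    pose proof (inverse_nonneg _ _ hd di) as i0.
    pose proof (rmul_req _ _ _ _ di (req_refl (f @ (s @ n + v)))) as di'.
    assert (small : H |- - e < 0) by linear (hd, hd, de).
    assert (one_two : H |- 1 < 1 + 1) by linear rlt_0_1.
    or_e (rlt_cotrans _ _ (f @ (s @ n + v)) small) as hc.
    + or_e (rlt_cotrans _ _ (i * f @ (s @ n + v)) one_two) as hi;
        pose proof (rmul_pos _ _ hd (pos_of_rlt _ _ hi)) as q.
      * apply p_or_i2.
        assert (fc : H |- 0 < f @ (s @ n + v)) by linear (q, di', hd).
        pose proof (ramp_of_ge_1 _ (rlt_le _ _ hi)) as g.
        pose proof (rmul_req _ _ _ _ g (req_refl v)) as gv.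
        assert (el : H |- s' == s @ n) by linear (step, gv).
        assert (er : H |- s' + v == s @ n + v) by linear el.
        get fl from hf (s', s @ n, l', l, el).
        get fr from hf (s' + v, s @ n + v, r', c_itv, er).
        apply p_and_i; [linear (fs, fl) | linear (fc, fr)].
      * apply p_or_i1. ex_i (s @ n + v). apply p_and_i; [exact c_itv |].
        apply abs_lt; [linear (q, di', de) | linear hc].
    + apply p_or_i2.
      pose proof (rmul_nonneg _ _ i0 (rlt_le _ _ (pos_of_rlt _ _ hc))) as q.
      assert (t0 : H |- i * f @ (s @ n + v) <= 0) by linear q.
      pose proof (ramp_of_nonpos _ t0) as g.
      pose proof (rmul_req _ _ _ _ g (req_refl v)) as gv.
      assert (el : H |- s' == s @ n + v) by linear (step, gv).
      assert (er : H |- s' + v == s @ n + w @ n) by linear (el, hw).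
      get fl from hf (s', s @ n + v, l', c_itv, el).
      get fr from hf (s' + v, s @ n + w @ n, r', r, er).
      apply p_and_i; [linear (hc, fl) | linear (fsw, fr)].
Qed.

(** The limit [c] of the intervals is an approximate zero unless one was met among
    the midpoints: at both ends of a short enough interval around it, [f] is within
    [e] of [f c], and its values there have opposite signs. *)
Lemma approximate_intermediate_value {G} {H : list (tm G O)} {A : Reals H}
    (a b e : tm G R) (f : tm G (R ~> R)) :
  H |- a <= b ->
  H |- respects_eq_on a b f ->
  H |- continuous_on a b f ->
  H |- f @ a < 0 ->
  H |- 0 < f @ b ->
  H |- 0 < e ->
  H |- EX x : R, in_itv ^a ^b x /\ abs (^f @ x) < ^e.
Proof.
  intros hab hf hcont fa fb he.
  assert (hd : H |- EX d : R, 0 < d /\ d + d == ^e).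
  { ex_e half as h hh. pose proof (rmul_req _ _ _ _ hh (req_refl e)) as k.
    assert (de : H |- h * e + h * e == e) by linear k.
    ex_i (h * e). apply p_and_i; [apply pos_half; linear (he, de) | exact de]. }
  ex_e hd as d hd'. and_e hd' as dpos de.
  ex_e (rinv d (p_or_i2 _ _ _ _ dpos)) as i di.
  ex_e (vanishing_halving_sequence (b - a) (nonneg_of_rle _ _ hab)) as w hw.
  and_e hw as w0 hw1. and_e hw1 as wS hw2. and_e hw2 as wnn wM.
  ex_e wM as M hM.
  ex_e (bisection_sequence (H := H) a i f w) as s hs. and_e hs as s0 sS.
  (* The left end advances by a fraction of [w (n + 1)] between [0] and [1], and the
     length drops by [w (n + 1)], so the right end does not advance. *)
  assert (nest : H |- ALL n : N, ^s @ n <= ^s @ tS n /\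
    ^s @ tS n + ^w @ tS n <= ^s @ n + ^w @ n).
  { all_i n. get k from sS n. get p from wnn (tS n). get q from wS n.
    set (g := ramp _) in k.
    pose proof (rmul_nonneg _ _ (ramp_nonneg (H := H) _ : H |- 0 <= g) p) as l.
    pose proof (rmul_nonneg _ _
      (nonneg_of_rle _ _ (ramp_le_1 (H := H) _ : H |- g <= 1)) p) as m.
    apply p_and_i; [linear (k, l) | linear (k, q, m)]. }
  norm_in nest.
  assert (dom : H |- ALL n : N, ^a <= ^s @ n /\ ^s @ n + ^w @ n <= ^b).
  { ind_i n IH.
    - apply p_and_i; [linear s0 | linear (s0, w0)].
    - and_e IH as k1 k2. get k from nest n. and_e k as k3 k4.
      apply p_and_i; [linear (k1, k3) | linear (k2, k4)]. }
  norm_in dom.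
  ex_e (nested_intervals s w M nest wnn hM) as c hc.
  assert (c_itv : H |- a <= c /\ c <= b).
  { get k from hc (@tO G). and_e k as k1 k2.
    apply p_and_i; [linear (k1, s0) | linear (k2, s0, w0)]. }
  get hcont' from hcont (c, c_itv, e, he).
  ex_e hcont' as r hr. and_e hr as rpos near.
  ex_e (vanishing_lt w M r wnn hM rpos) as n wn.
  assert (hf' : H |- respects_eq_on a b f) by (norm; exact hf).
  pose proof (approximate_zero_or_sign_change a b e d i f s w hf' fa fb dpos de di
    s0 w0 wS wnn sS dom) as alt.
  norm_in alt. spec_in alt n.
  or_e alt as sign; [exact sign |].
  and_e sign as fl fr.
  get k from hc n. and_e k as k1 k2. get k' from dom n. and_e k' as k3 k4.
  get p from wnn n.
  assert (l_itv : H |- a <= s @ n /\ s @ n <= b) by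
    (apply p_and_i; [exact k3 | linear (k4, p)]).
  assert (r_itv : H |- a <= s @ n + w @ n /\ s @ n + w @ n <= b) by
    (apply p_and_i; [linear (k3, p) | exact k4]).
  assert (l_near : H |- abs (s @ n - c) < r) by
    (apply abs_lt; [linear (k1, rpos) | linear (k2, wn)]).
  assert (r_near : H |- abs (s @ n + w @ n - c) < r) by
    (apply abs_lt; [linear (k1, wn) | linear (k2, rpos)]).
  get nl from near (s @ n, l_itv, l_near).
  get nr from near (s @ n + w @ n, r_itv, r_near).
  ex_i c. apply p_and_i; [exact c_itv |].
  apply abs_lt.
  - pose proof (opp_lt_of_abs_lt _ _ nl) as q. linear (q, fl).
  - pose proof (lt_of_abs_lt _ _ nr) as q. linear (q, fr).
Qed.

Theorem theorem1p1 :
  real_axioms |-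
    ALL a : R, ALL b : R, ALL f : R ~> R,
      a <= b ==>
      respects_eq_on a b f ==>
      continuous_on a b f ==>
      f @ a < 0 ==>
      0 < f @ b ==>
      ALL e : R, 0 < e ==>
        EX x : R, in_itv a b x /\ abs (f @ x) < e.
Proof.
  pose proof real_axioms_Reals as A. revert A. generalize real_axioms as H. intros H A.
  all_i a. all_i b. all_i f. imp_i hab. imp_i hf. imp_i hc. imp_i fa. imp_i fb.
  all_i e. imp_i he.
  assert (hf' : H |- respects_eq_on a b f) by (norm; exact hf).
  assert (hc' : H |- continuous_on a b f) by (norm; exact hc).
  pose proof (approximate_intermediate_value a b e f hab hf' hc' fa fb he) as k.
  norm_in k. exact k.
Qed.
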